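(* Let $k$ be a field, $n\ge 2$, $R=k[X_1,\dots,X_n]$ with the standard grading, $\mathfrak m=(X_1,\dots,X_n)$, and let $I=(f_0,\dots,f_n)\subset R$ be generated by $k$-linearly independent forms $f_0,\dots,f_n$ of the same degree $d\ge 1$. If $I$ is $\mathfrak m$-primary, then $$\left\lfloor\frac{(n-1)(d-1)}{2}\right\rfloor\le\mu_0(I)\le(n-1)(d-1),$$ and equality on the left holds if the forms $f_0,\dots,f_n$ are sufficiently general and $k$ has characteristic $0$.
   Context: $H_i$ denotes the $i$-th homology module of the graded Koszul complex $K_\bullet(f_0,\dots,f_n;R)$ (with degree-preserving differentials, so $K_i\simeq R(-id)^{\binom{n+1}{i}}$). For a graded module $M$, $\mathrm{indeg}(M)=\inf\{\mu : M_\mu\ne 0\}$, with $\mathrm{indeg}(0)=+\infty$. The threshold degree of $I$ is $$\mu_0(I)=(n-1)(d-1)-\min\{\mathrm{indeg}(H_1),\ \mathrm{indeg}(H^0_{\mathfrak m}(H_1))-d\}.$$ ''Sufficiently general'' means that the coefficients of $(f_0,\dots,f_n)$ lie in a suitable non-empty Zariski open subset of the affine space of coefficients of $(n+1)$-tuples of forms of degree $d$ in $n$ variables. Standing assumption in the paper: $\dim k[f_0,\dots,f_n]=\dim R$. *)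

(* Defs.v *)
(* The order of the imports matters: importing mpoly after constructive_ereal
   fails (clash of notation levels). *)
From mathcomp Require Import all_boot all_order all_algebra.
From mathcomp Require Import mpoly.
From mathcomp Require Import classical_sets constructive_ereal.

Set Implicit Arguments.
Unset Strict Implicit.
Unset Printing Implicit Defensive.

Import Order.TTheory GRing.Theory Num.Theory.
Local Open Scope classical_set_scope.
Local Open Scope ring_scope.

Definition ideal_span (A : comNzRingType) (S : set A) : set A :=
  [set x | exists (r : nat) (c s : 'I_r -> A),
     (forall i, S (s i)) /\ x = \sum_(i < r) c i * s i].

Definition ideal_mul (A : comNzRingType) (I J : set A) : set A :=
  ideal_span [set z | exists x y, [/\ I x, J y & z = x * y]].

Fixpoint ideal_exp (A : comNzRingType) (I : set A) (N : nat) : set A :=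
  if N is N'.+1 then ideal_mul I (ideal_exp I N') else [set: A].

Definition radical (A : comNzRingType) (I : set A) : set A :=
  [set x | exists N : nat, I (x ^+ N)].

Definition primary_ideal (A : comNzRingType) (I : set A) : Prop :=
  ~ I 1 /\ forall x y, I (x * y) -> I x \/ radical I y.

Definition irrelevant_ideal (k : fieldType) (n : nat) : set {mpoly k[n]} :=
  ideal_span (range (fun i : 'I_n => 'X_i : {mpoly k[n]})).
Arguments irrelevant_ideal : clear implicits.

Definition m_primary (k : fieldType) (n : nat) (I : set {mpoly k[n]}) : Prop :=
  primary_ideal I /\ radical I = irrelevant_ideal k n.

(* The piece R_nu of R = k[X_1, ..., X_n], for nu in Z. *)
Definition poly_piece (k : fieldType) (n : nat) (nu : int) :
    set {mpoly k[n]} :=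
  [set p | match nu with
           | Posz e => p \is e.-homog
           | Negz _ => p = 0
           end].

(* A graded module given as a subquotient sq_num / sq_den of an ambient
   module; its piece of degree mu is the image of the elements of sq_num
   lying in sq_piece mu.  Homology modules are kept in this form because
   their zero test is not a boolean predicate. *)
Record subquot (A : nzRingType) := Subquot {
  sq_amb : lmodType A;
  sq_num : set sq_amb;
  sq_den : set sq_amb;
  sq_piece : int -> set sq_amb
}.

Definition piece_neq0 (A : nzRingType) (M : subquot A) (mu : int) : Prop :=
  exists x : sq_amb M, [/\ sq_num x, sq_piece mu x & ~ sq_den x].

(* The infimum is taken in Z extended by -oo and +oo. *)
Definition indeg (A : nzRingType) (M : subquot A) : \bar int :=
  infimum +oo%E [set mu%:E | mu in [set mu : int | piece_neq0 M mu]].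

(* The 0-th local cohomology module with support in the irrelevant ideal:
   the classes killed by some power of that ideal. *)
Definition H0m (k : fieldType) (n : nat) (M : subquot {mpoly k[n]}) :
    subquot {mpoly k[n]} :=
  {| sq_amb := sq_amb M;
     sq_num := [set x | sq_num x /\
                  exists N : nat, forall g,
                    ideal_exp (irrelevant_ideal k n) N g -> sq_den (g *: x)];
     sq_den := @sq_den _ M;
     sq_piece := @sq_piece _ M |}.

(* The exterior algebra of R^r as a free R-module: a S is the coordinate of
   a on e_{i_1} /\ ... /\ e_{i_p}, where S = {i_1 < ... < i_p}. *)
Notation koszul_alg k n r := {ffun {set 'I_r} -> {mpoly k[n]}^o}.

Definition koszul_mod (k : fieldType) (n r p : nat) : set (koszul_alg k n r) :=
  [set a | forall S : {set 'I_r}, #|S| != p -> a S = 0].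

(* e_{i_1} /\ ... /\ e_{i_p} is sent to the sum over t of
   (-1)^(t-1) f_{i_t} times the wedge product with e_{i_t} omitted; here the
   coordinates of the image are collected. *)
Definition koszul_diff (k : fieldType) (n r : nat) (f : 'I_r -> {mpoly k[n]})
    (a : koszul_alg k n r) : koszul_alg k n r :=
  [ffun S : {set 'I_r} =>
     (\sum_(j < r | j \notin S)
        (-1) ^+ #|[pred l in S | (l < j)%N]| * f j * a (j |: S)%SET
      : {mpoly k[n]}^o)].

(* The p-th Koszul homology of forms f of degree d.  The generators of K_p
   sit in degree p * d, i.e. K_p = R(-pd)^binomial(r, p). *)
Definition koszul_H (k : fieldType) (n r : nat) (f : 'I_r -> {mpoly k[n]})
    (d p : nat) : subquot {mpoly k[n]} :=
  {| sq_amb := koszul_alg k n r;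
     sq_num := [set a | koszul_mod p a /\ koszul_diff f a = 0];
     sq_den := [set a | exists2 b, koszul_mod p.+1 b & koszul_diff f b = a];
     sq_piece := fun mu =>
       [set a | forall S, poly_piece (mu - p%:Z * d%:Z) (a S)] |}.

Definition threshold_degree (k : fieldType) (n r : nat)
    (f : 'I_r -> {mpoly k[n]}) (d : nat) : \bar int :=
  (((n%:Z - 1) * (d%:Z - 1))%:E
   - Order.min (indeg (koszul_H f d 1))
               (indeg (H0m (koszul_H f d 1)) - d%:Z%:E))%E.

Definition lin_indep (k : fieldType) (n r : nat) (f : 'I_r -> {mpoly k[n]}) :
    Prop :=
  forall c : 'I_r -> k, \sum_(i < r) c i *: f i = 0 -> forall i, c i = 0.

Definition zariski_open (k : fieldType) (N : nat) (U : set ('I_N -> k)) :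
    Prop :=
  exists P : set {mpoly k[N]}, U = [set a | exists2 p, P p & p.@[a] != 0].

(* Indices of the coefficients of r-tuples of forms of degree d. *)
Definition coef_index (n r d : nat) : finType :=
  ('I_r * {m : 'X_{1..n < d.+1} | mdeg m == d})%type.

Definition coef_point (k : fieldType) (n r d : nat)
    (f : 'I_r -> {mpoly k[n]}) : 'I_#|coef_index n r d| -> k :=
  fun t => let im : coef_index n r d := enum_val t in
           (f im.1)@_(bmnm (val im.2)).
Arguments coef_point {k n r} d f.

(* Main.v *)
Require Import Defs.
From HB Require Import structures.
From mathcomp Require Import all_boot all_order all_algebra.
From mathcomp Require Import mpoly.
From mathcomp Require Import boolp classical_sets constructive_ereal.
From mathcomp Require Import ring zify.

Set Implicit Arguments.
Unset Strict Implicit.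
Unset Printing Implicit Defensive.

Import Order.TTheory GRing.Theory Num.Theory.
Local Open Scope ring_scope.

(* In each degree, the vanishing of the first Koszul homology is an equality
   rank M_2 + rank M_1 = dim K_1 between the ranks of the last two Koszul
   differentials, and ranks of matrices can only drop under specialization.  As
   H_1 is killed by I, the threshold degree is (n - 1)(d - 1) minus the least
   coefficient degree nu of a syzygy that is not a combination of Koszul
   syzygies; let nu_0 be half of (n - 1)(d - 1), rounded up.

   Lower bound: if H_1 vanished for f in coefficient degree nu_0, then it would
   also vanish for the generic forms g_0, ..., g_n over the field of fractions of
   the ring of coefficients.  Comparison with X_1^d, ..., X_n^d shows that
   A = R/(g_1, ..., g_n) has the Hilbert function of R/(X_1^d, ..., X_n^d), which
   is strictly smaller in degree nu_0 + d than in degree nu_0.  The kernel of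
   g_0 : A_(nu_0) -> A_(nu_0 + d) then yields a syzygy that is not Koszul.

   Generic equality: in characteristic 0 the forms X_1^d, ..., X_n^d and
   (X_1 + ... + X_n)^d have no such syzygy below nu_0, by the strong Lefschetz
   property of R/(X_1^d, ..., X_n^d), and this is an open condition. *)

(** * Ranks of matrices indexed by finite types *)

Definition fun_mx (S : Type) (I J : finType) (g : I -> J -> S) :
    'M[S]_(#|I|, #|J|) :=
  \matrix_(i, j) g (enum_val i) (enum_val j).

Definition fun_row (S : Type) (I : finType) (v : I -> S) : 'rV[S]_#|I| :=
  \row_i v (enum_val i).

Lemma fun_rowK (S : Type) (I : finType) (x : 'rV[S]_#|I|) :
  fun_row (fun i => x 0 (enum_rank i)) = x.
Proof. by apply/rowP=> i; rewrite mxE enum_valK. Qed.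

Lemma fun_row_inj (S : Type) (I : finType) (v w : I -> S) :
  fun_row v = fun_row w -> v =1 w.
Proof. by move=> /rowP vw i; move: (vw (enum_rank i)); rewrite !mxE enum_rankK. Qed.

Lemma eq_fun_row (S : Type) (I : finType) (v w : I -> S) :
  v =1 w -> fun_row v = fun_row w.
Proof. by move=> vw; apply/rowP=> i; rewrite !mxE. Qed.

Lemma mul_fun_row (S : nzRingType) (I J : finType) (v : I -> S)
    (g : I -> J -> S) :
  fun_row v *m fun_mx g = fun_row (fun j => \sum_i v i * g i j).
Proof.
apply/rowP=> j.
rewrite !mxE [RHS](reindex (fun i : 'I_#|I| => enum_val i)) /=; last first.
  by exists enum_rank => i _; rewrite ?enum_valK ?enum_rankK.
by apply: eq_bigr => i _; rewrite !mxE.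
Qed.

Lemma row_fun_mx (S : Type) (I J : finType) (g : I -> J -> S) i :
  row i (fun_mx g) = fun_row (g (enum_val i)).
Proof. by apply/rowP=> j; rewrite !mxE. Qed.

Lemma fun_row_submx (F : fieldType) (I J : finType) (v : J -> F)
    (g : I -> J -> F) :
  (fun_row v <= fun_mx g)%MS <-> exists c : I -> F, forall j, v j = \sum_i c i * g i j.
Proof.
split=> [/submxP[D] | [c vE]].
  rewrite -(fun_rowK D) mul_fun_row => /fun_row_inj vE.
  by exists (fun i => D 0 (enum_rank i)).
by rewrite (eq_fun_row vE) -mul_fun_row submxMl.
Qed.

Lemma sub_fun_mx (F : fieldType) (J : finType) m p (A : 'M[F]_(m, #|J|))
    (B : 'M[F]_(p, #|J|)) :
  (forall v : J -> F, (fun_row v <= A)%MS -> (fun_row v <= B)%MS) ->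
  (A <= B)%MS.
Proof.
by move=> AB; apply/row_subP=> i; rewrite -(fun_rowK (row i A)) AB // fun_rowK row_sub.
Qed.

Lemma fun_mx_mul0 (F : fieldType) (I J L : finType) (g : I -> J -> F)
    (h : J -> L -> F) :
  (forall i l, \sum_j g i j * h j l = 0) -> fun_mx g *m fun_mx h = 0.
Proof.
move=> gh; apply/row_matrixP=> i; rewrite row_mul row_fun_mx mul_fun_row row0.
by apply/rowP=> l; rewrite !mxE gh.
Qed.

(** Exactness puts the kernel of [h] inside the row space of [g]; rank-nullity for [h] does the
    rest. *)
Lemma exact_le_rank (F : fieldType) (I J L : finType) (g : I -> J -> F)
    (h : J -> L -> F) :
  (forall v : J -> F, (forall l, \sum_j v j * h j l = 0) ->
     exists c : I -> F, forall j, v j = \sum_i c i * g i j) ->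
  (#|J| <= \rank (fun_mx g) + \rank (fun_mx h))%N.
Proof.
move=> exgh; rewrite addnC -leq_subLR -mxrank_ker.
apply/mxrankS/sub_fun_mx => v /sub_kermxP.
rewrite mul_fun_row => /rowP vh; apply/fun_row_submx/exgh => l.
by have := vh (enum_rank l); rewrite !mxE enum_rankK.
Qed.

(** In a complex the row space of [g] lies in the kernel of [h]; the rank inequality excludes a
    proper inclusion. *)
Lemma rank_le_exact (F : fieldType) (I J L : finType) (g : I -> J -> F)
    (h : J -> L -> F) :
  (forall i l, \sum_j g i j * h j l = 0) ->
  (#|J| <= \rank (fun_mx g) + \rank (fun_mx h))%N ->
  forall v : J -> F, (forall l, \sum_j v j * h j l = 0) ->
     exists c : I -> F, forall j, v j = \sum_i c i * g i j.
Proof.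
move=> gh rgh v vh; apply/fun_row_submx.
have gk : (fun_mx g <= kermx (fun_mx h))%MS by apply/sub_kermxP/fun_mx_mul0.
have /eqmxP eqgk : (fun_mx g == kermx (fun_mx h))%MS.
  by rewrite -(mxrank_leqif_eq gk).2 eqn_leq mxrankS //= mxrank_ker leq_subLR addnC.
by rewrite eqgk; apply/sub_kermxP; rewrite mul_fun_row; apply/rowP=> l; rewrite !mxE vh.
Qed.

(* [s] is the determinant of a product [B1 *m M *m B2] which psi maps to the
   identity matrix of size the rank of [map_mx psi M]. *)
Lemma rank_semicontinuous (k : fieldType) (S : comNzRingType) p q
    (M : 'M[S]_(p, q)) (psi : {rmorphism S -> k}) (iota : {rmorphism k -> S}) :
  cancel iota psi ->
  exists s : S, psi s != 0 /\
    forall (K : fieldType) (theta : {rmorphism S -> K}), theta s != 0 ->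
      (\rank (map_mx psi M) <= \rank (map_mx theta M))%N.
Proof.
move=> iotaK; pose A := map_mx psi M.
have /row_fullP[B1 B1A] := col_base_full A.
have /row_freeP[B2 AB2] := row_base_free A.
exists (\det (map_mx iota B1 *m M *m map_mx iota B2)); split.
  rewrite -det_map_mx !map_mxM /=.
  have mK m1 m2 (B : 'M[k]_(m1, m2)) : map_mx psi (map_mx iota B) = B.
    by apply/matrixP=> i j; rewrite !mxE iotaK.
  rewrite !mK -[map_mx psi M](mulmx_base A) mulmxA B1A mul1mx AB2 det1.
  exact: oner_neq0.
(* A nonzero determinant makes the product invertible of size [\rank A], and a product has at most
   the rank of its middle factor. *)
move=> K theta; rewrite -det_map_mx !map_mxM /= -unitfE -[_ \is a _]/(_ \in unitmx).
rewrite -row_full_unit => /eqP rk; rewrite -/A -{1}rk.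
by apply: leq_trans (mxrankM_maxl _ _) (mxrankM_maxr _ _).
Qed.

(** * Graded pieces of the Koszul differentials *)

(* The monomials of degree e - q; there are none if e < q. *)
Definition mon (n q e : nat) : Type :=
  {m : 'X_{1..n < e.+1} | (mdeg m + q == e)%N}.
HB.instance Definition _ n q e := Finite.on (mon n q e).

Definition mon_val n q e (x : mon n q e) : 'X_{1..n} := bmnm (val x).
Coercion mon_val : mon >-> multinom.

Section MonomialSums.

Variables (S : nzRingType) (n : nat).
Implicit Types (m : 'X_{1..n}) (p : {mpoly S[n]}).

Lemma mdeg_mon q e (x : mon n q e) : (mdeg x + q)%N = e.
Proof. exact/eqP/(valP x). Qed.

Lemma mon_val_inj q e : injective (@mon_val n q e).
Proof. by move=> x y /val_inj/val_inj. Qed.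

Lemma monP q e m : (mdeg m + q)%N = e -> exists x : mon n q e, m = x.
Proof.
move=> me; have lt_me : (mdeg m < e.+1)%N by rewrite -me ltnS leq_addr.
have Pm : (mdeg (BMultinom lt_me) + q == e)%N by apply/eqP.
by exists (exist _ (BMultinom lt_me) Pm).
Qed.

Definition mon_poly q e (v : mon n q e -> S) : {mpoly S[n]} :=
  \sum_(x : mon n q e) v x *: 'X_[x].

Lemma mcoeff_mon_poly q e (v : mon n q e -> S) (x : mon n q e) :
  (mon_poly v)@_x = v x.
Proof.
rewrite raddf_sum (bigD1 x) //= mcoeffZ mcoeffX eqxx mulr1 big1 ?addr0 // => y nyx.
by rewrite mcoeffZ mcoeffX (inj_eq (@mon_val_inj _ _)) (negPf nyx) mulr0.
Qed.

Lemma mon_poly_homog q e (v : mon n q e -> S) m :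
  (mon_poly v)@_m != 0 -> (mdeg m + q)%N = e.
Proof.
apply: contra_neq_eq => ne; rewrite raddf_sum big1 //= => x _.
rewrite mcoeffZ mcoeffX; case: eqP => [xm|]; rewrite ?mulr0 //.
by case/eqP: ne; rewrite -xm mdeg_mon.
Qed.

Lemma mon_polyK q e p :
  (forall m, p@_m != 0 -> (mdeg m + q)%N = e) ->
  mon_poly (fun x : mon n q e => p@_x) = p.
Proof.
move=> hp; apply/mpolyP=> m; have [/monP[x ->]|ne] := eqVneq (mdeg m + q)%N e.
  exact: mcoeff_mon_poly.
have /eqP -> : p@_m == 0 by apply: contraNT ne => /hp ->.
by apply/eqP; apply: contraNT ne => /mon_poly_homog ->.
Qed.

Lemma mcoeffM_homog0 d p f m :
  f \is d.-homog -> (forall k, (mdeg k + d)%N = mdeg m -> p@_k = 0) ->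
  (p * f)@_m = 0.
Proof.
move=> hf p0; rewrite mcoeffM big1 // => -[k1 k2] /= /eqP/(congr1 mdeg).
rewrite mdegD; have [k2d mk|nk2 _] := eqVneq (mdeg (bmnm k2)) d.
  by rewrite p0 ?mul0r // -k2d -mk.
by rewrite (dhomog_nemf_coeff hf nk2) mulr0.
Qed.

(** Only the component of [p] of degree [mdeg m - d] reaches this coefficient, so [p] can be
    truncated to [p1]. *)
Lemma mcoeffM_mon q e d p f m :
  f \is d.-homog -> (mdeg m + q)%N = e ->
  (p * f)@_m = \sum_(x : mon n (q + d) e) p@_x * ('X_[x] * f)@_m.
Proof.
move=> hf me; pose p1 := mon_poly (fun x : mon n (q + d) e => p@_x).
rewrite -[p in LHS](subrK p1) mulrDl mcoeffD.
rewrite (@mcoeffM_homog0 d) ?add0r // => [|k mk]; last first.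
  have /monP[x ->] : (mdeg k + (q + d))%N = e by rewrite addnCA addnC mk.
  by rewrite mcoeffB mcoeff_mon_poly subrr.
by rewrite mulr_suml raddf_sum; apply: eq_bigr => x _ /=; rewrite -scalerAl mcoeffZ.
Qed.

Lemma mpoly_eq0_mon e p :
  (forall m, p@_m != 0 -> mdeg m = e) -> (forall y : mon n 0 e, p@_y = 0) -> p = 0.
Proof.
move=> hp p0; apply/mpolyP=> m; rewrite mcoeff0.
have [me|ne] := eqVneq (mdeg m) e; last first.
  by apply/eqP; apply: contraNT ne => /hp ->.
have /monP[x ->] : (mdeg m + 0)%N = e by rewrite addn0.
exact: p0.
Qed.

End MonomialSums.

(* The second differential is given on a redundant generating set: all ordered
   pairs [(i, j)] are used instead of the pairs [i < j]. *)
Definition koszul1_coef (S : nzRingType) n r d e (f : 'I_r -> {mpoly S[n]})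
    (x : 'I_r * mon n d e) (y : mon n 0 e) : S :=
  ('X_[x.2] * f x.1)@_y.

Definition koszul2_coef (S : nzRingType) n r d e (f : 'I_r -> {mpoly S[n]})
    (x : ('I_r * 'I_r) * mon n (d + d) e) (y : 'I_r * mon n d e) : S :=
  ('X_[x.2] * (f x.1.1 *+ (y.1 == x.1.2) - f x.1.2 *+ (y.1 == x.1.1)))@_y.2.

Definition koszul1_mx (S : nzRingType) n r d e (f : 'I_r -> {mpoly S[n]}) :=
  fun_mx (@koszul1_coef S n r d e f).

Definition koszul2_mx (S : nzRingType) n r d e (f : 'I_r -> {mpoly S[n]}) :=
  fun_mx (@koszul2_coef S n r d e f).

(** Antisymmetrizing an arbitrary matrix [C] gives every element of the second exterior power
    without ordering the indices. No degree is imposed on [C]; truncation recovers it. *)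
Definition koszul_bound (S : nzRingType) n r (f u : 'I_r -> {mpoly S[n]}) :=
  exists C : 'I_r -> 'I_r -> {mpoly S[n]},
    forall l, u l = \sum_j (C j l - C l j) * f j.

Definition koszul_exact (S : nzRingType) n r d e (f : 'I_r -> {mpoly S[n]}) :=
  forall u : 'I_r -> {mpoly S[n]},
    (forall j m, (u j)@_m != 0 -> (mdeg m + d)%N = e) ->
    \sum_j u j * f j = 0 -> koszul_bound f u.

Lemma eq_koszul1_mx (S : nzRingType) n r d e (f g : 'I_r -> {mpoly S[n]}) :
  f =1 g -> koszul1_mx d e f = koszul1_mx d e g.
Proof. by move=> fg; apply/matrixP=> i j; rewrite !mxE /koszul1_coef fg. Qed.

Lemma eq_koszul2_mx (S : nzRingType) n r d e (f g : 'I_r -> {mpoly S[n]}) :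
  f =1 g -> koszul2_mx d e f = koszul2_mx d e g.
Proof. by move=> fg; apply/matrixP=> i j; rewrite !mxE /koszul2_coef !fg. Qed.

Lemma map_koszul1_mx (S T : nzRingType) (h : {rmorphism S -> T}) n r d e
    (f : 'I_r -> {mpoly S[n]}) :
  map_mx h (koszul1_mx d e f) = koszul1_mx d e (fun j => map_mpoly h (f j)).
Proof.
apply/matrixP=> i j; rewrite !mxE /koszul1_coef -mcoeff_map_mpoly.
by rewrite rmorphM /= map_mpolyX.
Qed.

Lemma map_koszul2_mx (S T : nzRingType) (h : {rmorphism S -> T}) n r d e
    (f : 'I_r -> {mpoly S[n]}) :
  map_mx h (koszul2_mx d e f) = koszul2_mx d e (fun j => map_mpoly h (f j)).
Proof.
apply/matrixP=> i j; rewrite !mxE /koszul2_coef -mcoeff_map_mpoly.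
rewrite rmorphM /= map_mpolyX.
by rewrite rmorphB !rmorphMn.
Qed.

Lemma sum_pair (V : nmodType) (I J : finType) (G : I * J -> V) :
  \sum_x G x = \sum_i \sum_j G (i, j).
Proof. by rewrite pair_bigA; apply: eq_bigr => -[]. Qed.

Section KoszulRanks.

Variables (F : fieldType) (n r d : nat) (f : 'I_r -> {mpoly F[n]}).
Hypothesis fhom : forall j, f j \is d.-homog.

Lemma koszul1_sum e (v : 'I_r * mon n d e -> F) (y : mon n 0 e) :
  \sum_x v x * koszul1_coef f x y =
  (\sum_j mon_poly (fun m => v (j, m)) * f j)@_y.
Proof.
rewrite raddf_sum sum_pair.
apply: eq_bigr => j _; rewrite mulr_suml raddf_sum; apply: eq_bigr => m _ /=.
by rewrite -scalerAl mcoeffZ.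
Qed.

Lemma koszul2_sum e (c : ('I_r * 'I_r) * mon n (d + d) e -> F) (y : 'I_r * mon n d e) :
  let D i j := mon_poly (fun m => c ((i, j), m)) in
  \sum_x c x * koszul2_coef f x y =
  (\sum_j (D j y.1 - D y.1 j) * f j)@_y.2.
Proof.
move=> D; case: y => l y /=.
pose G i j := (D i j * (f i *+ (l == j) - f j *+ (l == i)))@_y.
transitivity (\sum_i \sum_j G i j).
  rewrite !sum_pair; apply: eq_bigr => i _; apply: eq_bigr => j _.
  rewrite /G mulr_suml raddf_sum; apply: eq_bigr => m _ /=.
  by rewrite -scalerAl mcoeffZ.
have GE i : \sum_j G i j =
    \sum_j (D i j * (f i *+ (l == j)))@_y - \sum_j (D i j * (f j *+ (l == i)))@_y.
  by rewrite -sumrB; apply: eq_bigr => j _; rewrite /G mulrBr mcoeffB.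
rewrite (eq_bigr _ (fun i _ => GE i)) sumrB [X in _ - X]exchange_big /= [RHS]raddf_sum /=.
rewrite -sumrB; apply: eq_bigr => j _.
rewrite mulrBl mcoeffB; congr (_ - _); rewrite (bigD1 l) //= eqxx mulr1n big1 ?addr0 //.
  by move=> i nil; rewrite eq_sym (negPf nil) mulr0n mulr0 mcoeff0.
by move=> i nil; rewrite eq_sym (negPf nil) mulr0n mulr0 mcoeff0.
Qed.

Lemma koszul1_homog e (u : 'I_r -> {mpoly F[n]}) :
  (forall j m, (u j)@_m != 0 -> (mdeg m + d)%N = e) ->
  forall m, (\sum_j u j * f j)@_m != 0 -> mdeg m = e.
Proof.
move=> hu m; apply: contra_neq_eq => nme; rewrite raddf_sum big1 //= => j _.
apply: mcoeffM_homog0 (fhom j) _ => k mk.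
by apply/eqP; apply: contraNT nme => /hu; rewrite mk => ->.
Qed.

(** Each row of [koszul2_mx] is a monomial times a Koszul syzygy, with [f a] in position [b] and
    [- f b] in position [a]. *)
Lemma koszul21_eq0 e (i : ('I_r * 'I_r) * mon n (d + d) e) (l : mon n 0 e) :
  \sum_(j : 'I_r * mon n d e) koszul2_coef f i j * koszul1_coef f j l = 0.
Proof.
rewrite (koszul1_sum (koszul2_coef f i)) /koszul2_coef.
case: i => -[a b] m /=.
under eq_bigr => j _.
  rewrite mon_polyK; first over.
  move=> m'.
  have /dhomogP hh : 'X_[m] * (f a *+ (j == b) - f b *+ (j == a)) \is (mdeg m + d)%N.-homog.
    by rewrite dhomogM ?dhomogX ?eqxx // rpredB // rpredMn.
  by rewrite -mcoeff_msupp => /hh ->; rewrite -addnA mdeg_mon.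
under eq_bigr => j _ do rewrite -mulrA mulrBl mulrBr.
rewrite sumrB (bigD1 b) //= eqxx mulr1n (big1 _ (fun j => j != b)); last first.
  by move=> j /negPf ->; rewrite mulr0n mul0r mulr0.
rewrite (bigD1 a) //= eqxx mulr1n (big1 _ (fun j => j != a)); last first.
  by move=> j /negPf ->; rewrite mulr0n mul0r mulr0.
by rewrite !addr0 [f b * f a]mulrC subrr mcoeff0.
Qed.

Lemma koszul_exact_rank e : koszul_exact d e f ->
  (#|{: 'I_r * mon n d e}| <=
     \rank (koszul2_mx d e f) + \rank (koszul1_mx d e f))%N.
Proof.
move=> exf; apply: exact_le_rank => v vf.
pose u j := mon_poly (fun m => v (j, m)).
have hu j m : (u j)@_m != 0 -> (mdeg m + d)%N = e by apply: mon_poly_homog.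
have [|C uC] := exf u hu.
  by apply: mpoly_eq0_mon (koszul1_homog hu) _ => y; rewrite -koszul1_sum vf.
(* Only the coefficients of [C] of degree [e - 2 d] are kept; by [mcoeffM_mon] they determine the
   products in degree [e - d]. *)
exists (fun x : ('I_r * 'I_r) * mon n (d + d) e => (C x.1.1 x.1.2)@_x.2) => -[l y].
rewrite koszul2_sum /= -(mcoeff_mon_poly (fun m => v (l, m))) -/(u l) uC.
have CE a b j (z : mon n d e) : (C a b * f j)@_z =
    (mon_poly (fun m : mon n (d + d) e => (C a b)@_m) * f j)@_z.
  rewrite (mcoeffM_mon _ (fhom j) (mdeg_mon z)) mulr_suml raddf_sum.
  by apply: eq_bigr => m _; rewrite /= -scalerAl mcoeffZ.
rewrite !raddf_sum; apply: eq_bigr => j _ /=.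
by rewrite !mulrBl !mcoeffB !CE.
Qed.

Lemma rank_koszul_exact e :
  (#|{: 'I_r * mon n d e}| <=
     \rank (koszul2_mx d e f) + \rank (koszul1_mx d e f))%N ->
  koszul_exact d e f.
Proof.
move=> rk u hu uf0; pose v (x : 'I_r * mon n d e) := (u x.1)@_x.2.
have uE j : mon_poly (fun m => v (j, m)) = u j by exact: (mon_polyK (hu j)).
have [|c vE] := rank_le_exact (@koszul21_eq0 e) rk (v := v).
  by move=> y; rewrite koszul1_sum /=; under eq_bigr do rewrite uE; rewrite uf0 mcoeff0.
pose D i j := mon_poly (fun m => c ((i, j), m)).
exists D => l; apply/mpolyP=> m.
have homD : forall m, (\sum_j (D j l - D l j) * f j)@_m != 0 -> (mdeg m + d)%N = e.
  move=> m'; apply: contra_neq_eq => ne; rewrite raddf_sum big1 //= => j _.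
  apply: mcoeffM_homog0 (fhom j) _ => k mk.
  have D0 a b : (D a b)@_k = 0.
    by apply/eqP; apply: contraNT ne => /mon_poly_homog; rewrite addnA mk => ->.
  by rewrite mcoeffB !D0 subrr.
have [/monP[y ->]|ne] := eqVneq (mdeg m + d)%N e.
  by have := koszul2_sum c (l, y); rewrite -vE.
have /eqP -> : (u l)@_m == 0 by apply: contraNT ne => /hu ->.
by apply/esym/eqP; apply: contraNT ne => /homD ->.
Qed.

Lemma koszul_rank_le e :
  (\rank (koszul2_mx d e f) + \rank (koszul1_mx d e f) <=
     #|{: 'I_r * mon n d e}|)%N.
Proof. exact/mulmx0_rank_max/fun_mx_mul0/koszul21_eq0. Qed.

End KoszulRanks.

(** * Powers of the variables and the strong Lefschetz property *)

Definition gen_by (S : nzRingType) n r (f : 'I_r -> {mpoly S[n]})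
    (p : {mpoly S[n]}) :=
  exists q : 'I_r -> {mpoly S[n]}, p = \sum_j q j * f j.

Section GenBy.

Variables (S : comNzRingType) (n r : nat) (f : 'I_r -> {mpoly S[n]}).

Lemma gen_by0 : gen_by f 0.
Proof. by exists (fun=> 0); rewrite big1 // => j _; rewrite mul0r. Qed.

Lemma gen_byD p q : gen_by f p -> gen_by f q -> gen_by f (p + q).
Proof.
case=> a -> [b ->]; exists (fun j => a j + b j).
by rewrite -big_split /=; apply: eq_bigr => j _; rewrite mulrDl.
Qed.

Lemma gen_byM p q : gen_by f q -> gen_by f (p * q).
Proof.
case=> b ->; exists (fun j => p * b j).
by rewrite mulr_sumr; apply: eq_bigr => j _; rewrite mulrA.
Qed.

Lemma gen_byN p : gen_by f p -> gen_by f (- p).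
Proof. by rewrite -mulN1r; apply: gen_byM. Qed.

Lemma gen_byB p q : gen_by f p -> gen_by f q -> gen_by f (p - q).
Proof. by move=> fp fq; apply/gen_byD/gen_byN. Qed.

Lemma gen_byZ c p : gen_by f p -> gen_by f (c *: p).
Proof. by rewrite -mul_mpolyC; apply: gen_byM. Qed.

Lemma gen_by_sum (I : Type) (s : seq I) (P : pred I) (p : I -> {mpoly S[n]}) :
  (forall i, P i -> gen_by f (p i)) -> gen_by f (\sum_(i <- s | P i) p i).
Proof. by move=> fp; elim/big_ind: _ => //; [exact: gen_by0 | exact: gen_byD]. Qed.

Lemma gen_by_gen j : gen_by f (f j).
Proof.
exists (fun i => (i == j)%:R); rewrite (bigD1 j) //= eqxx mul1r big1 ?addr0 // => i.
by move=> /negPf ->; rewrite mul0r.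
Qed.

End GenBy.

(** Once [u ord0] is written in terms of [f1], subtracting Koszul syzygies that involve [f ord0]
    kills this coordinate and leaves a syzygy of [f1]. *)
Lemma koszul_bound_ext (S : comNzRingType) n r
    (f u : 'I_r.+1 -> {mpoly S[n]}) (f1 := fun j => f (lift ord0 j)) :
  (forall v, \sum_j v j * f1 j = 0 -> koszul_bound f1 v) ->
  gen_by f1 (u ord0) -> \sum_j u j * f j = 0 -> koszul_bound f u.
Proof.
move=> exf1 [q u0E] uf0.
have [|C vE] := exf1 (fun j => u (lift ord0 j) + q j * f ord0).
  rewrite -[RHS]uf0 big_ord_recl u0E mulr_suml -big_split /=.
  by apply: eq_bigr => j _; rewrite mulrDl addrC -!mulrA [f _ * _]mulrC.
(* Column [ord0] carries the coefficients [q] of the subtracted syzygies, row [ord0] is zero, and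
   the remaining block is [C]. *)
exists (fun a b => if unlift ord0 a is Some i then
                     (if unlift ord0 b is Some j then C i j else q i) else 0).
move=> l; have [i ->|->] := unliftP ord0 l; rewrite big_ord_recl unlift_none.
  rewrite sub0r mulNr addrC -[LHS](addrK (q i * f ord0)) vE; congr (_ - _).
  by apply: eq_bigr => j _; rewrite liftK.
rewrite subrr mul0r add0r u0E; apply: eq_bigr => j _.
by rewrite liftK subr0.
Qed.

Lemma mcoeffMX_le (S : nzRingType) n (p : {mpoly S[n]}) (k m : 'X_{1..n}) :
  (p * 'X_[k])@_m = if (k <= m)%MM then p@_(m - k) else 0.
Proof.
case: ifPn => [km|nkm]; first by rewrite -{1}(submK km) addmC mcoeffMX.
apply/eqP; apply: contraNT nkm; rewrite -mcoeff_msupp (perm_mem (msuppMX _ _)).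
by case/mapP=> m' _ ->; apply: lem_addr.
Qed.

Section VarPowers.

Variables (k : comNzRingType) (n d : nat).

Definition var_powers r (s : 'I_r -> 'I_n) : 'I_r -> {mpoly k[n]} :=
  fun j => 'X_(s j) ^+ d.

Lemma lem_mulmn1 i (m : 'X_{1..n}) : (U_(i) *+ d <= m)%MM = (d <= m i)%N.
Proof.
apply/mnm_lepP/idP => [/(_ i)|di j]; first by rewrite mulmnE mnm1E eqxx mul1n.
by rewrite mulmnE mnm1E; case: eqP => [<-|]; rewrite ?mul1n ?mul0n.
Qed.

(** The ideal is monomial, so membership is decided on each monomial of the support separately. *)
Lemma gen_by_var_powersP r (s : 'I_r -> 'I_n) p :
  gen_by (var_powers s) p <-> forall m, p@_m != 0 -> exists j, (d <= m (s j))%N.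
Proof.
split=> [[q ->] m nz|pJ].
  apply/existsP; apply: contraNT nz => /existsPn nd.
  rewrite raddf_sum big1 // => j _ /=.
  by rewrite /var_powers mpolyXn mcoeffMX_le lem_mulmn1 (negPf (nd j)).
rewrite (mpolyE p) big_seq; apply: gen_by_sum => m; rewrite mcoeff_msupp => /pJ[j dj].
have -> : 'X_[m] = 'X_[m - U_(s j) *+ d] * var_powers s j :> {mpoly k[n]}.
  by rewrite /var_powers mpolyXn -mpolyXD submK // lem_mulmn1.
exact/gen_byZ/gen_byM/gen_by_gen.
Qed.

(** Multiplying by a power of one variable leaves the other exponents unchanged, so this power is a
    nonzerodivisor modulo the remaining ones, and [koszul_bound_ext] gives the induction. *)
Lemma var_powers_regular r (s : 'I_r -> 'I_n) : injective s ->
  forall u, \sum_j u j * var_powers s j = 0 -> koszul_bound (var_powers s) u.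
Proof.
elim: r s => [|r IHr] s inj_s u; first by exists (fun _ _ => 0) => -[].
have inj_s1 : injective (fun j => s (lift ord0 j)) by move=> i j /inj_s/lift_inj.
move=> uf0; apply: koszul_bound_ext (uf0); first exact: IHr inj_s1.
apply/gen_by_var_powersP => m nz.
have : gen_by (var_powers (fun j => s (lift ord0 j))) (u ord0 * var_powers s ord0).
  exists (fun j => - u (lift ord0 j)); apply/eqP; rewrite -subr_eq0 -sumrN.
  rewrite -[X in _ == X]uf0 big_ord_recl; apply/eqP; congr (_ + _).
  by apply: eq_bigr => j _; rewrite mulNr opprK.
move=> /gen_by_var_powersP/(_ (U_(s ord0) *+ d + m)%MM).
rewrite /var_powers mpolyXn mcoeffMX => /(_ nz)[j dj]; exists j; move: dj.
by rewrite mnmDE mulmnE mnm1E (inj_eq inj_s).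
Qed.

End VarPowers.

Section StrongLefschetz.

Variables (k : fieldType) (n d : nat).
Hypotheses (d_gt0 : (0 < d)%N) (k_char0 : [pchar k] =i pred0).

Let R := {mpoly k[n]}.
Let inJ : R -> Prop := gen_by (var_powers k d id).
Let ell : R := \sum_i 'X_i.

(* With multiplication by [ell], this is an sl2-triple: [lowering] acts on the
   i-th tensor factor k[X_i]/(X_i^d) by X_i^a |-> a (d - a) X_i^(a-1). *)
Definition lowering (p : R) : R :=
  \sum_i (d.-1%:R *: p^`M(i) - 'X_i * p^`M(i)^`M(i)).

Lemma mderiv_homog m i (p : R) : p \is m.-homog -> p^`M(i) \is m.-1.-homog.
Proof.
move=> hp; apply/dhomogP => a; rewrite mcoeff_msupp mcoeff_deriv => nz /=.
have : p@_(a + U_(i)) != 0 by apply: contraNneq nz => ->; rewrite mul0rn.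
rewrite -mcoeff_msupp => /(dhomog_mf hp) /=; rewrite mdegD mdeg1 => <-.
by rewrite addn1.
Qed.

Lemma euler m (p : R) : p \is m.-homog -> \sum_i 'X_i * p^`M(i) = m%:R *: p.
Proof.
move=> hp; rewrite {2}(mpolyE p) scaler_sumr.
have -> : \sum_i 'X_i * p^`M(i) =
    \sum_(a <- msupp p) p@_a *: \sum_i 'X_i * 'X_[k, a]^`M(i).
  under [RHS]eq_bigr do rewrite scaler_sumr.
  rewrite exchange_big /=; apply: eq_bigr => i _.
  rewrite {1}(mpolyE p) raddf_sum mulr_sumr; apply: eq_bigr => a _ /=.
  by rewrite mderivZ scalerAr.
rewrite !big_seq; apply: eq_bigr => a /(dhomog_mf hp) /= <-.
rewrite scalerA mulrC -scalerA; congr (_ *: _).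
rewrite mdegE natr_sum scaler_suml; apply: eq_bigr => i _.
rewrite mderivX -scalerAr -mpolyXD; have [->|a_gt0] := posnP (a i).
  by rewrite !scale0r.
congr (_ *: 'X_[_]); rewrite addmC submK //; apply/mnm_lepP=> j.
by rewrite mnm1E; case: eqP => [<-|].
Qed.

Lemma mderiv_ell i : ell^`M(i) = 1.
Proof.
rewrite raddf_sum (bigD1 i) //= mderivX mnm1E eqxx scale1r.
have -> : (U_(i) - U_(i) = 0 :> 'X_{1..n})%MM.
  by apply/mnmP=> j; rewrite mnmBE subnn mnm0E.
rewrite mpolyX0 big1 ?addr0 // => j nji.
by rewrite mderivX mnm1E (negPf nji) scale0r.
Qed.

(** With [D_i] the i-th partial derivative, the i-th summand contributes [(d - 1) - 2 X_i D_i] to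
    the commutator; Euler's identity sums these to the weight [n (d - 1) - 2 m]. *)
Lemma lowering_ell m (p : R) : p \is m.-homog ->
  lowering (ell * p) = ell * lowering p + ((n * d.-1)%:R - (2 * m)%:R) *: p.
Proof.
move=> hp; rewrite /lowering mulr_sumr.
rewrite scalerBl natrM natrM -2!scalerA -(euler hp).
have -> : n%:R *: (d.-1%:R *: p) = \sum_(i < n) d.-1%:R *: p.
  by rewrite sumr_const card_ord scaler_nat.
rewrite scaler_sumr -sumrB -big_split /=; apply: eq_bigr => i _.
rewrite !mderivM mderiv_ell mul1r mderivD mderivM mderiv_ell mul1r.
by rewrite -!mul_mpolyC !rmorph_nat; ring.
Qed.

Lemma lowering_homog m (p : R) : p \is m.-homog -> lowering p \is m.-1.-homog.
Proof.
move=> hp; apply: rpred_sum => i _; apply: rpredB.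
  exact/rpredZ/mderiv_homog.
have := mderiv_homog i (mderiv_homog i hp).
(* For [m <= 1] the truncated predecessors give the wrong degree to [X_i] times the second
   derivative, but that derivative is zero. *)
case: m hp => [|[|m]] hp /= h2.
- have -> : p^`M(i)^`M(i) = 0; last by rewrite mulr0 rpred0.
  apply/mpolyP=> a; rewrite mcoeff0 mcoeff_deriv mcoeff_deriv.
  by rewrite (dhomog_nemf_coeff hp) ?mul0rn //= !mdegD !mdeg1 !addn1.
- have -> : p^`M(i)^`M(i) = 0; last by rewrite mulr0 rpred0.
  apply/mpolyP=> a; rewrite mcoeff0 mcoeff_deriv mcoeff_deriv.
  by rewrite (dhomog_nemf_coeff hp) ?mul0rn //= !mdegD !mdeg1 !addn1.
- by rewrite -add1n dhomogM // dhomogX /= mdeg1.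
Qed.

Lemma lowering_const (p : R) : p \is 0.-homog -> lowering p = 0.
Proof.
move=> hp; rewrite /lowering big1 // => i _.
have -> : p^`M(i) = 0; last by rewrite mderiv0 scaler0 mulr0 subrr.
apply/mpolyP=> a; rewrite mcoeff0 mcoeff_deriv (dhomog_nemf_coeff hp) ?mul0rn //.
by rewrite /= mdegD mdeg1 addn1.
Qed.

Lemma mderivXn i j e : ('X_i ^+ e : R)^`M(j) = e%:R *: 'X_i ^+ e.-1 *+ (i == j).
Proof.
have X1 : ('X_i : R)^`M(j) = (i == j)%:R.
  rewrite mderivX mnm1E; case: eqP => [->|]; rewrite ?scale0r // scale1r.
  have -> : (U_(j) - U_(j) = 0 :> 'X_{1..n})%MM.
    by apply/mnmP=> l; rewrite mnmBE subnn mnm0E.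
  by rewrite mpolyX0.
elim: e => [|e IHe]; first by rewrite expr0 mderivC scale0r mul0rn.
rewrite exprS mderivM X1 IHe; case: (i == j); last by rewrite !mulr0n mul0r mulr0 addr0.
rewrite !mulr1n mul1r -scalerAr; case: e {IHe} => [|e /=].
  by rewrite scale0r addr0 scale1r.
by rewrite -exprS -[e.+2]add1n natrD scalerDl scale1r.
Qed.

(** [lowering] kills [X_j^d], as [(d - 1) d - d (d - 1) = 0], and the cross terms coming from a
    cofactor are again multiples of [X_j^d]. *)
Lemma lowering_ideal (p : R) : inJ p -> inJ (lowering p).
Proof.
case=> q ->; apply: gen_by_sum => i _.
rewrite !(raddf_sum (mderiv i)) /= mulr_sumr scaler_sumr -sumrB; apply: gen_by_sum => j _.
have Jj : gen_by (fun i : 'I_n => 'X_i ^+ d : R) ('X_j ^+ d).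
  exact: (gen_by_gen (var_powers k d id) j).
rewrite /var_powers !mderivM mderivXn mderivD !mderivM mderivXn.
case: eqP => [<-{i}|_]; last first.
  rewrite !mulr0n mderiv0 !(mulr0, addr0).
  by apply: gen_byB; [exact/gen_byZ/gen_byM | do 2!apply: gen_byM].
rewrite !mulr1n mderivZ mderivXn eqxx mulr1n.
case: d d_gt0 Jj => // e _ Jj /=.
have -> : e%:R *: ((q j)^`M(j) * 'X_j ^+ e.+1 + q j * (e.+1%:R *: 'X_j ^+ e)) -
  'X_j * ((q j)^`M(j)^`M(j) * 'X_j ^+ e.+1 + (q j)^`M(j) * (e.+1%:R *: 'X_j ^+ e) +
     ((q j)^`M(j) * (e.+1%:R *: 'X_j ^+ e) + q j * (e.+1%:R *: (e%:R *: 'X_j ^+ e.-1)))) =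
  (e%:R *: (q j)^`M(j) - 'X_j * (q j)^`M(j)^`M(j) - (e.+1%:R *: (q j)^`M(j)) *+ 2)
   * 'X_j ^+ e.+1; last by apply: gen_byM.
(* For [e = 0] the exponent [e.-1] is a default value, but its coefficient [e%:R] vanishes. *)
case: e {Jj} => [|e] /=; rewrite -!mul_mpolyC !exprS; ring.
Qed.

Lemma ell_homog : ell \is 1.-homog.
Proof. by apply: rpred_sum => i _; rewrite dhomogX /= mdeg1. Qed.

Lemma ellX_homog j m (p : R) : p \is m.-homog -> ell ^+ j * p \is (j + m)%N.-homog.
Proof.
by move=> hp; apply: dhomogM => //; have := dhomogMn j ell_homog; rewrite mul1n.
Qed.

(** The scalar is the sum of the weights [n (d - 1) - 2 (m + i)] for [i <= j]; the bound on [j]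
    keeps the natural subtractions exact. *)
Lemma lowering_ellX j m (p : R) : p \is m.-homog ->
  (2 * m + j <= n * d.-1)%N ->
  lowering (ell ^+ j.+1 * p) = ell ^+ j.+1 * lowering p +
    (j.+1 * (n * d.-1 - 2 * m - j))%:R *: (ell ^+ j * p).
Proof.
move=> hp; elim: j => [|j IHj] le.
  by rewrite expr1 expr0 mul1r (lowering_ell hp) mul1n subn0 natrB //; lia.
rewrite exprS -mulrA (lowering_ell (ellX_homog _ hp)) IHj; last lia.
rewrite mulrDr mulrA -exprS -scalerAr mulrA -exprS -addrA -scalerDl.
congr (_ + _ *: _).
have -> : (n * d.-1 = (n * d.-1 - 2 * m - j.+1) + 2 * m + j.+1)%N by lia.
move: (_ - j.+1)%N => t; rewrite -2!subnDA.
have -> : (t + 2 * m + j.+1 - (2 * m + j) = t.+1)%N by lia.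
have -> : (t + 2 * m + j.+1 - (2 * m + j.+1) = t)%N by lia.
ring.
Qed.

(* If [ell^j p] is in the ideal, then applying [lowering] shows that so is
   [ell^(j+1) (lowering p)], hence [lowering p] by induction on m; as the scalar
   in [lowering_ellX] is nonzero, [ell^(j-1) p] is in the ideal too. *)
Lemma strong_lefschetz m j (p : R) : p \is m.-homog ->
  (2 * m + j <= n * d.-1)%N -> inJ (ell ^+ j * p) -> inJ p.
Proof.
elim/ltn_ind: m j p => m IHm j p hp; elim: j => [|j IHj] le; rewrite ?mul1r // => Jp.
have Jlow : inJ (ell ^+ j.+1 * lowering p).
  case: m => [|m] in hp le IHm {IHj} *.
    by rewrite (lowering_const hp) mulr0; apply: gen_by0.
  (* Lowering the degree by one frees two units in the bound, which allows the larger exponent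
     [j.+2]. *)
  apply: gen_byM; apply: (IHm m _ j.+2) => //; [exact: lowering_homog hp | lia |].
  have := lowering_ideal Jp; rewrite (lowering_ellX hp); last lia.
  set c := (_ * _)%:R => Jlp.
  have -> : ell ^+ j.+2 * lowering p =
      ell * (ell ^+ j.+1 * lowering p + c *: (ell ^+ j * p)) - c *: (ell ^+ j.+1 * p).
    by rewrite mulrDr mulrA -exprS -scalerAr mulrA -exprS addrK.
  by apply: gen_byB; [exact: gen_byM | exact: gen_byZ].
have := gen_byB (lowering_ideal Jp) Jlow; rewrite (lowering_ellX hp); last lia.
set c := (_ * _)%:R; have c_neq0 : c != 0.
  by move/pcharf0P: k_char0 => ->; rewrite muln_eq0 /=; lia.
rewrite addrAC subrr add0r => /(gen_byZ c^-1); rewrite scalerA mulVf //.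
by rewrite scale1r; apply: IHj; lia.
Qed.

End StrongLefschetz.

(** * The Hilbert function of the monomial complete intersection *)

Section BoxCount.

Variable d : nat.

(* The Hilbert function of k[X_1, ..., X_n]/(X_1^(d+1), ..., X_n^(d+1)). *)
Definition box n e : nat := #|[set f : {ffun 'I_n -> 'I_d.+1} | (\sum_i f i == e)%N]|.

Lemma box_max n (f : {ffun 'I_n -> 'I_d.+1}) : (\sum_i f i <= n * d)%N.
Proof.
by rewrite -[leqRHS](_ : \sum_(i < n) d = _)%N ?leq_sum ?sum_nat_const ?card_ord //
  => i _; rewrite -ltnS.
Qed.

Lemma box_eq0 n e : (n * d < e)%N -> box n e = 0%N.
Proof.
move=> lt_e; apply/eqP; rewrite /box cards_eq0; apply/negPn/negP=> /set0Pn[f].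
by rewrite inE => /eqP fe; move: lt_e; rewrite -fe ltnNge box_max.
Qed.

(** The reflection of every coordinate, [f i] to [d - f i], exchanges the two sets. *)
Lemma box_sym n e : (e <= n * d)%N -> box n (n * d - e)%N = box n e.
Proof.
move=> le_e; pose r (f : {ffun 'I_n -> 'I_d.+1}) := [ffun i => rev_ord (f i)].
have rK : involutive r by move=> f; apply/ffunP=> i; rewrite !ffunE rev_ordK.
have r_sum f : (\sum_i r f i + \sum_i f i = n * d)%N.
  rewrite -big_split /= -[RHS](_ : \sum_(i < n) d = _)%N; last first.
    by rewrite sum_nat_const card_ord.
  by apply: eq_bigr => i _; rewrite ffunE /= subSS subnK // -ltnS.
rewrite /box -(card_imset _ (inv_inj rK)); congr #|pred_of_set _|; apply/setP=> f.
rewrite -{1}[f]rK (mem_imset _ _ (inv_inj rK)) !inE.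
by have := r_sum f; move: (\sum_i r f i)%N (\sum_i f i)%N => a b ab; apply/eqP/eqP; lia.
Qed.

Lemma box_polyE n e :
  (box n e)%:Z = ((\sum_(j < d.+1) 'X^j : {poly int}) ^+ n)`_e.
Proof.
have -> : (\sum_(j < d.+1) 'X^j : {poly int}) ^+ n =
    \prod_(i < n) \sum_(j < d.+1) 'X^j by rewrite prodr_const card_ord.
rewrite bigA_distr_bigA coef_sum /= /box -sum1dep_card -natz natr_sum.
rewrite [LHS]big_mkcond; apply: eq_bigr => f _ /=.
rewrite (_ : \prod_i 'X^(f i) = 'X^(\sum_i f i)); last first.
  by elim/big_rec2: _ => [|i x y _ ->]; rewrite ?expr0 // exprD.
by rewrite coefXn eq_sym; case: eqP.
Qed.

(** With [P = 1 + X + ... + X^d], compare the coefficients of [X^(e+1)] in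
    [P^(n+1) (X - 1) = P^n (X^(d+1) - 1)]. *)
Lemma box_rec n e :
  (box n.+1 e + box n e.+1 =
   box n.+1 e.+1 + (if d <= e then box n (e - d)%N else 0))%N.
Proof.
apply/eqP; rewrite -(eqr_nat int) !natrD.
pose P : {poly int} := \sum_(j < d.+1) 'X^j.
have PX : P ^+ n.+1 * ('X - 1) = P ^+ n * ('X^(d.+1) - 1).
  by rewrite exprSr -mulrA subrX1 [_ * P]mulrC.
move: (congr1 (fun p : {poly int} => p`_e.+1) PX).
rewrite !mulrBr !mulr1 !coefB coefMX coefMXn /= ltnS subSS.
have -> : ((if (d <= e)%N then box n (e - d)%N else 0)%N)%:R =
          (if (e < d)%N then 0 else (P ^+ n)`_(e - d)%N) :> int.
  by case: leqP => // _; rewrite natz box_polyE.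
rewrite !natz !box_polyE -/P => PXe; rewrite -subr_eq0 opprD addrACA PXe; apply/eqP; ring.
Qed.

Lemma box_gt0 n e : (e <= n * d)%N -> (0 < box n e)%N.
Proof.
move=> le_e; apply/card_gt0P.
(* Greedy filling: each coordinate takes what is left of [e], up to [d]. *)
exists [ffun i : 'I_n => inord (minn d (e - i * d)) : 'I_d.+1]; rewrite inE.
under eq_bigr => i _ do rewrite ffunE inordK ?ltnS ?geq_minl //.
suff -> : (\sum_(i < n) minn d (e - i * d) = minn e (n * d))%N by apply/eqP/minn_idPl.
by elim: n {le_e} => [|n IHn]; rewrite ?big_ord0 ?big_ord_recr /= ?IHn; lia.
Qed.

(** An [x] below the middle is reflected to [n * d - x]; in the upper half unit steps are
    chained. *)
Lemma box_le_of_step n :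
  (forall x, (n * d <= (2 * x).+1)%N -> (box n x.+1 <= box n x)%N) ->
  forall x y, (x <= y)%N -> (n * d <= x + y)%N -> (box n y <= box n x)%N.
Proof.
move=> step x y le_xy le_nd.
have chain z : (n * d <= 2 * z)%N -> (z <= y)%N -> (box n y <= box n z)%N.
  move=> le_z; move: y {le_xy le_nd} => y; elim: y => [|y IHy] le_zy.
    by have -> : z = 0%N by lia.
  have [<- //|/eqP ne] := eqVneq z y.+1.
  by apply: leq_trans (IHy _); [apply: step|]; lia.
have [le2|lt2] := leqP (n * d) (2 * x); first exact: chain.
by rewrite -[box n x]box_sym; [apply: chain|]; lia.
Qed.

(** By [box_rec], the drop from [x] to [x.+1] for [n.+1] is [box n (x - d) - box n x.+1], to which
    induction on [n] applies. *)
Lemma box_le n x y : (x <= y)%N -> (n * d <= x + y)%N -> (box n y <= box n x)%N.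
Proof.
elim: n x y => [|n IHn]; apply: box_le_of_step => x le_nd; first by rewrite box_eq0.
have := box_rec n x; have [le_dx|lt_xd] := leqP d x; last first.
  by rewrite (@box_eq0 n x.+1); lia.
have := IHn (x - d)%N x.+1; lia.
Qed.

Lemma box_lt_of_step n :
  (forall x, (n * d <= 2 * x)%N -> (x <= n * d)%N -> (box n x.+1 < box n x)%N) ->
  forall x y, (x < y)%N -> (n * d < x + y)%N -> (x <= n * d)%N ->
  (box n y < box n x)%N.
Proof.
move=> step x y lt_xy lt_nd le_x.
have chain z : (n * d <= 2 * z)%N -> (z <= n * d)%N -> (z < y)%N ->
    (box n y < box n z)%N.
  move=> le_z z_le lt_zy; apply: leq_ltn_trans (step z le_z z_le).
  by apply: box_le; lia.
have [le2|lt2] := leqP (n * d) (2 * x); first exact: chain.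
by rewrite -[box n x]box_sym //; apply: chain; lia.
Qed.

(** The induction starts at [n = 2], where the drop is [box 1 (x - d) > 0]; for [n = 1] the function
    is flat on [0, ..., d]. *)
Lemma box_lt n x y : (2 <= n)%N -> (x < y)%N -> (n * d < x + y)%N ->
  (x <= n * d)%N -> (box n y < box n x)%N.
Proof.
case: n => [|[|n]] // _; elim: n x y => [|n IHn]; apply: box_lt_of_step => x le2 le_x.
  have := box_rec 1 x; have -> : (d <= x)%N by lia.
  by rewrite (@box_eq0 1 x.+1); have := @box_gt0 1 (x - d)%N; lia.
have := box_rec n.+2 x; have -> : (d <= x)%N by lia.
have := IHn (x - d)%N x.+1; lia.
Qed.

End BoxCount.

Lemma card_mon_small n d e :
  #|[pred x : mon n 0 e | [forall i, (mon_val x i <= d)%N]]| = box d n e.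
Proof.
pose F (x : mon n 0 e) := [ffun i : 'I_n => inord (mon_val x i) : 'I_d.+1].
pose A := [set x : mon n 0 e | [forall i, (mon_val x i <= d)%N]].
have FE x i : x \in A -> F x i = mon_val x i :> nat.
  by rewrite inE => /forallP xd; rewrite ffunE inordK ?ltnS.
have F_inj : {in A &, injective F}.
  move=> x y xA yA Fxy; apply/mon_val_inj/mnmP => i.
  by rewrite -!FE // Fxy.
rewrite -[LHS]cardsE -/A /box -(card_in_imset F_inj); congr #|pred_of_set _|.
apply/setP=> f; rewrite inE; apply/imsetP/eqP => [[x xA ->]|fe].
  under eq_bigr => i _ do rewrite FE //.
  by rewrite -mdegE -[RHS](mdeg_mon x) addn0.
have [x xE] : exists x : mon n 0 e, [multinom (f i : nat) | i < n] = x.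
  apply: monP; rewrite addn0 mdegE -fe; apply: eq_bigr => i _.
  by rewrite mnmE.
have xA : x \in A by rewrite inE; apply/forallP => i; rewrite -xE mnmE -ltnS.
by exists x => //; apply/ffunP=> i; apply/val_inj; rewrite /= FE // -xE mnmE.
Qed.

Lemma rank_delta_mx (F : fieldType) (I J : finType) (h : I -> J) :
  injective h ->
  \rank (fun_mx (fun i j => (h i == j)%:R) : 'M[F]_(#|I|, #|J|)) = #|I|.
Proof.
move=> h_inj; apply/eqP/row_freeP.
exists (fun_mx (fun j i => (h i == j)%:R)); apply/row_matrixP=> i.
rewrite row_mul row_fun_mx mul_fun_row; apply/rowP=> l; rewrite !mxE.
rewrite (bigD1 (h (enum_val i))) //= eqxx mul1r big1 ?addr0 => [|j].
  by rewrite (inj_eq h_inj) (inj_eq enum_val_inj) eq_sym.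
by rewrite eq_sym => /negPf ->; rewrite mul0r.
Qed.

(** The row space is spanned by the monomials divisible by some [X_j^(d+1)], which [D] selects;
    [box] counts the others. *)
Lemma rank_var_powers (F : fieldType) n d e :
  (\rank (koszul1_mx d.+1 e (var_powers F d.+1 (@id 'I_n))) + box d n e =
   #|{: mon n 0 e}|)%N.
Proof.
pose good := [pred x : mon n 0 e | [forall i, (mon_val x i <= d)%N]].
pose B : finType := {x : mon n 0 e | ~~ good x}.
pose D : 'M[F]_(#|B|, #|{: mon n 0 e}|) :=
  fun_mx (fun (b : B) (y : mon n 0 e) => (val b == y)%:R).
have coefE j (x : mon n d.+1 e) (y : mon n 0 e) :
    koszul1_coef (var_powers F d.+1 id) (j, x) y =
    ((x + U_(j) *+ d.+1)%MM == y)%:R.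
  by rewrite /koszul1_coef /var_powers mpolyXn -mpolyXD mcoeffX.
have cardB : (#|B| + box d n e = #|{: mon n 0 e}|)%N.
  by rewrite card_sig -card_mon_small -(cardC good) addnC.
have rkD : \rank D = #|B| by apply: rank_delta_mx; apply: val_inj.
suff rkE : \rank D = \rank (koszul1_mx d.+1 e (var_powers F d.+1 (@id 'I_n))).
  by rewrite -rkE rkD.
have mulE j (x : mon n d.+1 e) :
    exists2 y : mon n 0 e, (x + U_(j) *+ d.+1)%MM = y & ~~ good y.
  have [|y yE] := @monP n 0 e (x + U_(j) *+ d.+1)%MM.
    by rewrite addn0 mdegD mdegMn mdeg1 mul1n mdeg_mon.
  exists y => //; rewrite negb_forall; apply/existsP; exists j.
  by rewrite -ltnNge -yE -lem_mulmn1 lem_addl.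
have divE (y : mon n 0 e) : ~~ good y ->
    exists j, exists x : mon n d.+1 e, (x + U_(j) *+ d.+1)%MM = y.
  rewrite negb_forall => /existsP[j]; rewrite -ltnNge => dj; exists j.
  have le_j : (U_(j) *+ d.+1 <= y)%MM by rewrite lem_mulmn1.
  have [|x xE] := @monP n d.+1 e (y - U_(j) *+ d.+1)%MM.
    have := mdeg_mon y; rewrite -{1}(submK le_j) mdegD mdegMn mdeg1 mul1n.
    by rewrite addn0.
  by exists x; rewrite -xE submK.
apply/eqmx_rank/andP; split; apply/row_subP=> i; rewrite row_fun_mx.
  case: (enum_val i) => y ybad; have [j [x xE]] := divE y ybad.
  apply/fun_row_submx; exists (fun z => (z == (j, x))%:R) => z.
  rewrite (bigD1 (j, x)) //= eqxx mul1r big1 ?addr0 => [|w /negPf ->]; last by rewrite mul0r.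
  by rewrite coefE xE (inj_eq (@mon_val_inj _ _ _)).
case: (enum_val i) => j x; have [y yE yB] := mulE j x.
apply/fun_row_submx; exists (fun b => (b == exist _ y yB)%:R) => z.
rewrite (bigD1 (exist _ y yB : B)) //= eqxx mul1r big1 ?addr0 => [|w /negPf ->].
  by rewrite coefE yE (inj_eq (@mon_val_inj _ _ _)).
by rewrite mul0r.
Qed.

(** * The powers of the variables and of their sum *)

Section Witness.

Variables (k : fieldType) (n d : nat).

Definition witness (j : 'I_n.+1) : {mpoly k[n]} :=
  if unlift ord0 j is Some i then 'X_i ^+ d else (\sum_i 'X_i) ^+ d.

Lemma witness_homog j : witness j \is d.-homog.
Proof.
rewrite /witness; case: unlift => [i|].
  by rewrite -[d in d.-homog]mul1n dhomogMn // dhomogX /= mdeg1.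
by rewrite -[d in d.-homog]mul1n dhomogMn // ell_homog.
Qed.

Lemma witness_lift i : witness (lift ord0 i) = 'X_i ^+ d.
Proof. by rewrite /witness liftK. Qed.

(** A syzygy puts [u ord0] times the d-th power of the sum of the variables into the ideal of the
    [X_i^d]; strong Lefschetz puts [u ord0] there, and [koszul_bound_ext] concludes. *)
Lemma witness_exact nu : (0 < d)%N -> [pchar k] =i pred0 ->
  (2 * nu + d <= n * d.-1)%N -> koszul_exact d (nu + d) witness.
Proof.
move=> d_gt0 k0 le_nu u hu uf0.
have sumE (v : 'I_n -> {mpoly k[n]}) :
    \sum_j v j * witness (lift ord0 j) = \sum_j v j * var_powers k d id j.
  by apply: eq_bigr => j _; rewrite witness_lift.
apply: koszul_bound_ext (uf0) => [v|].
  rewrite sumE => /(var_powers_regular (fun _ _ => id))[C vE].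
  by exists C => l; rewrite vE; apply: eq_bigr => j _; rewrite witness_lift.
suff [q ->] : gen_by (var_powers k d id) (u ord0) by exists q; rewrite sumE.
apply: (strong_lefschetz d_gt0 k0 (m := nu) (j := d)) => //.
  apply/dhomogP => m; rewrite mcoeff_msupp => /hu/eqP.
  by rewrite eqn_add2r => /eqP.
exists (fun j => - u (lift ord0 j)); apply/eqP; rewrite -subr_eq0 -sumrN.
rewrite -[X in _ == X]uf0 big_ord_recl /witness unlift_none [_ * u _]mulrC.
by apply/eqP; congr (_ + _); apply: eq_bigr => j _; rewrite mulNr opprK liftK.
Qed.

End Witness.

(** * Generic forms *)

(** Let A be the quotient by the ideal of [f1]. The first coordinate of a Koszul syzygy lies in that
    ideal, so exactness makes multiplication by [f ord0] injective from [A_nu] to [A_(nu+d)]. The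
    inequality compares the two dimensions. *)
Lemma koszul_exact_count (F : fieldType) n r d nu (f : 'I_r.+1 -> {mpoly F[n]})
    (f1 := fun j => f (lift ord0 j)) :
  (forall j, f j \is d.-homog) -> koszul_exact d (nu + d) f ->
  (#|{: mon n 0 nu}| + \rank (koszul1_mx d (nu + d) f1) <=
   #|{: mon n 0 (nu + d)}| + \rank (koszul1_mx d nu f1))%N.
Proof.
move=> fhom exf; set A := koszul1_mx d nu f1; set B := koszul1_mx d _ f1.
pose G : 'M[F]_(#|{: mon n 0 nu}|, #|{: mon n 0 (nu + d)}|) :=
  fun_mx (fun (x : mon n 0 nu) (y : mon n 0 (nu + d)) => ('X_[x] * f ord0)@_y).
(* This kernel consists of the [v] in degree [nu] whose product with [f ord0] lies in the ideal of
   [f1]. *)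
suff kA : (kermx (G *m cokermx B) <= A)%MS.
  have arith a b c p q : (c <= q -> b <= q - c -> p - b <= a -> p + c <= q + a)%N.
    by lia.
  apply: (arith _ (\rank (G *m cokermx B)) _ _ _ (rank_leq_col B)).
  by rewrite -mxrank_coker mxrankM_maxr.
  by rewrite -mxrank_ker mxrankS.
apply: sub_fun_mx => v /sub_kermxP; rewrite mulmxA => /eqP; rewrite -submxE.
rewrite mul_fun_row => /fun_row_submx[c cE].
pose u j := if unlift ord0 j is Some i
  then - mon_poly (fun m : mon n d (nu + d) => c (i, m)) else mon_poly v.
have hu j m : (u j)@_m != 0 -> (mdeg m + d)%N = (nu + d)%N.
  rewrite /u; case: unlift => [i|] => [|/mon_poly_homog <-]; last by rewrite addn0.
  by rewrite mcoeffN oppr_eq0 => /mon_poly_homog.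
have [|C uC] := exf u hu.
  apply: mpoly_eq0_mon (koszul1_homog fhom hu) _ => y.
  rewrite big_ord_recl mcoeffD /u unlift_none.
  have -> : (mon_poly v * f ord0)@_y = \sum_i c i * koszul1_coef f1 i y.
    rewrite -cE mulr_suml raddf_sum; apply: eq_bigr => x _ /=.
    by rewrite -scalerAl mcoeffZ.
  rewrite koszul1_sum -mcoeffD -big_split /= big1 ?mcoeff0 // => j _.
  by rewrite liftK mulNr subrr.
apply/fun_row_submx.
exists (fun x : 'I_r * mon n (0 + d) nu =>
          (C (lift ord0 x.1) ord0 - C ord0 (lift ord0 x.1))@_x.2) => x.
have := uC ord0; rewrite /u unlift_none big_ord_recl subrr mul0r add0r => vE.
rewrite -[LHS](mcoeff_mon_poly v) vE sum_pair raddf_sum; apply: eq_bigr => j _.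
exact: mcoeffM_mon (fhom _) (mdeg_mon x).
Qed.

Section GenericForms.

Variables (k : fieldType) (n r d : nat).
Let N := #|coef_index n r d|.

Definition generic_form (j : 'I_r) : {mpoly {mpoly k[N]}[n]} :=
  \sum_(x : {m : 'X_{1..n < d.+1} | mdeg m == d})
    'X_(enum_rank ((j, x) : coef_index n r d)) *: 'X_[bmnm (val x)].

Lemma generic_form_homog j : generic_form j \is d.-homog.
Proof.
by apply: rpred_sum => x _; apply: rpredZ; rewrite dhomogX; apply: (valP x).
Qed.

Lemma map_generic_form (f : 'I_r -> {mpoly k[n]}) j : f j \is d.-homog ->
  map_mpoly (meval (coef_point d f)) (generic_form j) = f j.
Proof.
move=> hf; apply/mpolyP=> m; rewrite mcoeff_map_mpoly !raddf_sum /=.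
have termE (x : {m : 'X_{1..n < d.+1} | mdeg m == d}) :
    (('X_(enum_rank ((j, x) : coef_index n r d)) *: 'X_[bmnm (val x)] :
       {mpoly {mpoly k[N]}[n]})@_m).@[coef_point d f] =
    (f j)@_(bmnm (val x)) * (bmnm (val x) == m)%:R.
  by rewrite mcoeffZ mcoeffX mevalM mevalXU rmorph_nat /coef_point enum_rankK.
rewrite (eq_bigr _ (fun x _ => termE x)).
have [md|nmd] := eqVneq (mdeg m) d; last first.
  rewrite (dhomog_nemf_coeff hf nmd) big1 // => x _.
  by case: eqP => [xm|]; rewrite ?mulr0 //; case/eqP: nmd; rewrite -xm; apply/eqP/(valP x).
have lt_md : (mdeg m < d.+1)%N by rewrite md.
have Pm : mdeg (BMultinom lt_md) == d by apply/eqP.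
rewrite (bigD1 (exist _ (BMultinom lt_md) Pm)) //= eqxx mulr1 big1 ?addr0 // => x.
by rewrite -!val_eqE /= => /negPf ->; rewrite mulr0.
Qed.

Lemma map_mpoly_homog (S T : nzRingType) (h : {rmorphism S -> T})
    (p : {mpoly S[n]}) :
  p \is d.-homog -> map_mpoly h p \is d.-homog.
Proof.
move=> hp; apply/dhomogP => m; rewrite mcoeff_msupp mcoeff_map_mpoly => nz.
apply: (dhomog_mf hp); rewrite mcoeff_msupp.
apply: contraNneq nz => ->.
by apply/eqP; exact: rmorph0.
Qed.

(** Where [s1] and [s2] do not vanish, both ranks are at least those for [w], so the rank criterion
    for exactness passes from [w] to [f]. *)
Lemma koszul_exact_open e (w : 'I_r -> {mpoly k[n]}) :
  (forall j, w j \is d.-homog) -> koszul_exact d e w ->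
  exists s : {mpoly k[N]}, s.@[coef_point d w] != 0 /\
    forall f : 'I_r -> {mpoly k[n]}, (forall j, f j \is d.-homog) ->
      s.@[coef_point d f] != 0 -> koszul_exact d e f.
Proof.
move=> hw exw.
have [s1 [nz1 rk1]] := rank_semicontinuous (koszul1_mx d e generic_form)
  (mevalC (coef_point d w)).
have [s2 [nz2 rk2]] := rank_semicontinuous (koszul2_mx d e generic_form)
  (mevalC (coef_point d w)).
exists (s1 * s2); split; first by rewrite mevalM mulf_neq0.
move=> f hf; rewrite mevalM mulf_eq0 negb_or => /andP[nzf1 nzf2].
apply: rank_koszul_exact => //; apply: leq_trans (koszul_exact_rank hw exw) _.
have := rk1 _ (meval (coef_point d f)) nzf1.
have := rk2 _ (meval (coef_point d f)) nzf2.
have mE g (hg : forall j, g j \is d.-homog) j := map_generic_form (hg j).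
rewrite !map_koszul1_mx !map_koszul2_mx.
rewrite !(eq_koszul1_mx _ _ (mE _ _)) // !(eq_koszul2_mx _ _ (mE _ _)) //.
by move=> le2 le1; apply: leq_add.
Qed.

(** The polynomial [s] is nonzero at [v], hence nonzero, and it stays so in the field of
    fractions. *)
Lemma koszul1_rank_tofrac q e (g : 'I_q -> {mpoly {mpoly k[N]}[n]})
    (v : 'I_N -> k) :
  (\rank (koszul1_mx d e (fun j => map_mpoly (meval v) (g j))) <=
   \rank (koszul1_mx d e (fun j => map_mpoly (@tofrac _) (g j))))%N.
Proof.
have [s [nz rk]] := rank_semicontinuous (koszul1_mx d e g) (mevalC v).
rewrite -!map_koszul1_mx; apply: rk; rewrite tofrac_eq0.
by apply: contraNneq nz => ->; apply/eqP; exact: meval0.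
Qed.

Lemma koszul2_rank_tofrac q e (g : 'I_q -> {mpoly {mpoly k[N]}[n]})
    (v : 'I_N -> k) :
  (\rank (koszul2_mx d e (fun j => map_mpoly (meval v) (g j))) <=
   \rank (koszul2_mx d e (fun j => map_mpoly (@tofrac _) (g j))))%N.
Proof.
have [s [nz rk]] := rank_semicontinuous (koszul2_mx d e g) (mevalC v).
rewrite -!map_koszul2_mx; apply: rk; rewrite tofrac_eq0.
by apply: contraNneq nz => ->; apply/eqP; exact: meval0.
Qed.

End GenericForms.

(** The forms have degree [d.+1], to match [box d]. The last inequality on [nu] places [nu] and
    [nu + d.+1] where [box d n] strictly decreases. *)
Lemma not_koszul_exact (k : fieldType) n d nu (f : 'I_n.+1 -> {mpoly k[n]}) :
  (2 <= n)%N -> (forall j, f j \is d.+1.-homog) ->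
  (nu <= n * d)%N -> (n * d < nu + (nu + d.+1))%N ->
  ~ koszul_exact d.+1 (nu + d.+1) f.
Proof.
move=> n_ge2 hf le_nu lt_nd exf.
(* The last [n] of the given forms may fail to be a regular sequence; generic forms allow a
   comparison with the powers of the variables. *)
pose G (j : 'I_n.+1) := map_mpoly (@tofrac _) (generic_form k n d.+1 j).
have hG (j : 'I_n.+1) : G j \is d.+1.-homog.
  exact/map_mpoly_homog/generic_form_homog.
have exG : koszul_exact d.+1 (nu + d.+1) G.
  apply: rank_koszul_exact => //; apply: leq_trans (koszul_exact_rank hf exf) _.
  have mE j := map_generic_form (hf j).
  have := koszul1_rank_tofrac (nu + d.+1) (@generic_form k n n.+1 d.+1)
    (coef_point d.+1 f).
  have := koszul2_rank_tofrac (nu + d.+1) (@generic_form k n n.+1 d.+1)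
    (coef_point d.+1 f).
  rewrite (eq_koszul1_mx _ _ mE) (eq_koszul2_mx _ _ mE).
  by move=> le2 le1; apply: leq_add.
(* The two ranks add up to at most the dimension of [K_1], with equality for the powers of the
   variables. Neither rank is smaller for [G], so both agree. *)
have rkG e : (\rank (koszul1_mx d.+1 e (fun i : 'I_n => G (lift ord0 i))) + box d n e =
              #|{: mon n 0 e}|)%N.
  rewrite -[RHS](rank_var_powers k n d e); congr (_ + _)%N.
  have mE (i : 'I_n) : map_mpoly (meval (coef_point d.+1 (@witness k n d.+1)))
      (generic_form k n d.+1 (lift ord0 i)) = var_powers k d.+1 id i.
    by rewrite map_generic_form; [exact: witness_lift | exact: witness_homog].
  have := koszul1_rank_tofrac e
    (fun i : 'I_n => @generic_form k n n.+1 d.+1 (lift ord0 i))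
    (coef_point d.+1 (@witness k n d.+1)).
  have := koszul2_rank_tofrac e
    (fun i : 'I_n => @generic_form k n n.+1 d.+1 (lift ord0 i))
    (coef_point d.+1 (@witness k n d.+1)).
  rewrite (eq_koszul1_mx _ _ mE) (eq_koszul2_mx _ _ mE) => le2 le1.
  have hX (i : 'I_n) : var_powers k d.+1 id i \is d.+1.-homog.
    by rewrite /var_powers -witness_lift witness_homog.
  have exX : koszul_exact d.+1 e (var_powers k d.+1 (@id 'I_n)).
    by move=> u _; apply: var_powers_regular.
  have arith a b a' b' c : (b + a <= c -> c <= b' + a' -> b' <= b -> a' <= a -> a = a')%N.
    by lia.
  exact: arith (koszul_rank_le (fun i => hG (lift ord0 i)) e)
    (koszul_exact_rank hX exX) le2 le1.
have lt_box : (box d n (nu + d.+1) < box d n nu)%N by apply: box_lt => //; lia.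
have arith a b c p q u v : (a + b <= c + u -> u + p = a -> v = b -> v + q = c -> p <= q)%N.
  by lia.
by move: lt_box; rewrite ltnNge (arith _ _ _ _ _ _ _ (koszul_exact_count hG exG)
  (rkG nu) erefl (rkG (nu + d.+1)%N)).
Qed.

(** * Koszul homology *)

(** The bound forces [nu < n * d], so only finitely many degrees matter and the product of their
    open conditions serves as [s]. *)
Lemma koszul_exact_generic (k : fieldType) n d : (0 < d)%N -> [pchar k] =i pred0 ->
  exists s : {mpoly k[#|coef_index n n.+1 d|]},
    s.@[coef_point d (@witness k n d)] != 0 /\
    forall f : 'I_n.+1 -> {mpoly k[n]}, (forall j, f j \is d.-homog) ->
      s.@[coef_point d f] != 0 ->
      forall nu, (2 * nu + d <= n * d.-1)%N -> koszul_exact d (nu + d) f.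
Proof.
move=> d_gt0 k0.
suff [s [nz exs]] : exists s : {mpoly k[#|coef_index n n.+1 d|]},
    s.@[coef_point d (@witness k n d)] != 0 /\
    forall f : 'I_n.+1 -> {mpoly k[n]}, (forall j, f j \is d.-homog) ->
      s.@[coef_point d f] != 0 ->
      forall nu, (nu < n * d)%N -> (2 * nu + d <= n * d.-1)%N ->
      koszul_exact d (nu + d) f.
  exists s; split=> // f hf nzf nu le_nu; apply: exs => //.
  have : (n * d.-1 <= n * d)%N by rewrite leq_mul2l leq_pred orbT.
  by lia.
elim: (n * d)%N => [|B [s [nz exs]]].
  by exists 1; split=> [|f hf nz nu]; rewrite ?meval1 ?oner_neq0.
have [le_B|nle_B] := boolP (2 * B + d <= n * d.-1)%N; last first.
  exists s; split=> // f hf nzf nu; rewrite ltnS leq_eqVlt => /predU1P[->|]; last exact: exs.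
  by rewrite (negPf nle_B).
have [s1 [nz1 exs1]] := koszul_exact_open (@witness_homog k n d)
  (witness_exact d_gt0 k0 le_B).
exists (s * s1); split=> [|f hf]; first by rewrite mevalM mulf_neq0.
rewrite mevalM mulf_eq0 negb_or => /andP[nzs nzs1] nu.
rewrite ltnS leq_eqVlt => /predU1P[-> _|]; first exact: exs1.
exact: exs.
Qed.

Section KoszulHomology.

Variables (k : fieldType) (n r : nat) (f : 'I_r -> {mpoly k[n]}).

Definition deg1_coord (a : koszul_alg k n r) (j : 'I_r) : {mpoly k[n]} := a [set j].

Definition of_deg1 (u : 'I_r -> {mpoly k[n]}) : koszul_alg k n r :=
  [ffun S => if [pick j | S == [set j]] is Some j then u j else 0].

Lemma of_deg1K u j : of_deg1 u [set j] = u j.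
Proof.
rewrite ffunE; case: pickP => [i /eqP/finset.set1_inj <- //|/(_ j)].
by rewrite eqxx.
Qed.

Lemma of_deg1_mod u : koszul_mod 1 (of_deg1 u).
Proof.
move=> S; rewrite ffunE; case: pickP => // i /eqP ->.
by rewrite cards1.
Qed.

Lemma koszul_diff_mod p (a : koszul_alg k n r) :
  koszul_mod p.+1 a -> koszul_mod p (koszul_diff f a).
Proof.
move=> ha S nS; rewrite ffunE big1 // => j jS.
by rewrite ha ?mulr0 // cardsU1 jS add1n eqSS.
Qed.

Lemma koszul_cycleP a : koszul_mod 1 a ->
  koszul_diff f a = 0 <-> \sum_j deg1_coord a j * f j = 0.
Proof.
move=> ha; have a0 : koszul_diff f a finset.set0 = \sum_j deg1_coord a j * f j.
  rewrite ffunE; apply: eq_big => [j|j _]; first by rewrite inE.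
  rewrite finset.setU0 [X in (-1) ^+ X](_ : _ = 0%N) ?expr0 ?mul1r 1?mulrC //.
  by apply: eq_card0 => l; rewrite !inE.
split=> [da0|s0]; first by rewrite -a0 da0 ffunE.
apply/ffunP=> S; rewrite [RHS]ffunE; have [->|nS] := eqVneq S finset.set0; first by rewrite a0.
by rewrite (koszul_diff_mod ha) // cards_eq0.
Qed.

Lemma koszul_diff1 (b : koszul_alg k n r) l :
  koszul_diff f b [set l] =
  \sum_(j | j != l) (-1) ^+ (l < j)%N * f j * b [set j; l].
Proof.
rewrite ffunE; apply: eq_big => [j|j _]; first by rewrite inE.
congr (_ ^+ _ * _ * _).
have [lj|jl] := boolP (l < j)%N.
  transitivity #|pred1 l|; last by rewrite card1.
  apply: eq_card => i; rewrite !inE.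
  by case: eqP => [->|].
by apply: eq_card0 => i; rewrite !inE; case: eqP => [->|] //=; exact/negbTE.
Qed.

(** The coordinate of [b] on [{i < j}] corresponds to [C i j - C j i]; from [b], an upper triangular
    [C] is enough. *)
Lemma koszul_boundaryP a : koszul_mod 1 a ->
  (exists2 b, koszul_mod 2 b & koszul_diff f b = a) <->
  koszul_bound f (deg1_coord a).
Proof.
move=> ha; split=> [[b _ <-]|[C aE]].
  exists (fun i j : 'I_r => if (i < j)%N then b [set i; j] else 0) => l.
  rewrite /deg1_coord koszul_diff1 [LHS]big_mkcond; apply: eq_bigr => j _ /=.
  case: (ltngtP j l) => [lt_jl|lt_lj|/val_inj ->]; last by rewrite eqxx subrr mul0r.
    by rewrite -val_eqE (ltn_eqF lt_jl) /= expr0 mul1r subr0 mulrC.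
  by rewrite -val_eqE (gtn_eqF lt_lj) /= expr1 sub0r mulN1r !mulNr mulrC finset.setUC.
pose D i j := C i j - C j i.
pose b : koszul_alg k n r := [ffun S =>
  if [pick p : 'I_r * 'I_r | (p.1 < p.2)%N && (S == [set p.1; p.2])] is Some p
  then D p.1 p.2 else 0].
have bE (i j : 'I_r) : (i < j)%N -> b [set i; j] = D i j.
  move=> lt_ij; rewrite ffunE; case: pickP => [[i' j'] /= /andP[lt_ij' /eqP ij]|].
    have := finset.set21 i j; have := finset.set22 i j; rewrite ij !inE.
    case/orP=> /eqP jE /orP[]/eqP iE; move: lt_ij lt_ij'; rewrite jE iE ?ltnn //.
    by move=> lt1 lt2; have := ltn_trans lt1 lt2; rewrite ltnn.
  by move=> /(_ (i, j)); rewrite /= lt_ij eqxx.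
have hb : koszul_mod 2 b.
  move=> S; rewrite ffunE; case: pickP => // -[i j] /= /andP[lt_ij /eqP ->].
  by rewrite cards2 -val_eqE (ltn_eqF lt_ij).
exists b => //; apply/ffunP=> S.
have [/cards1P[l ->]|nS] := boolP (#|S| == 1%N); last first.
  by rewrite (koszul_diff_mod hb) // ha.
rewrite -[RHS]/(deg1_coord a l) aE koszul_diff1 big_mkcond; apply: eq_bigr => j _ /=.
case: (ltngtP j l) => [lt_jl|lt_lj|/val_inj ->]; last by rewrite eqxx subrr mul0r.
  by rewrite -val_eqE (ltn_eqF lt_jl) /= bE // expr0 mul1r mulrC.
rewrite -val_eqE (gtn_eqF lt_lj) /= expr1 finset.setUC bE //.
rewrite /D mulN1r.
by rewrite mulNr -mulrN opprB mulrC.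
Qed.

End KoszulHomology.

(** * The threshold degree *)

Section IdealLemmas.

Variables (k : fieldType) (n r : nat) (f : 'I_r -> {mpoly k[n]}).

Lemma ideal_span_gen_by p : ideal_span (range f) p <-> gen_by f p.
Proof.
split=> [[q [c [s [sf ->]]]]|[c ->]].
  by apply: gen_by_sum => i _; have [j _ <-] := sf i; apply/gen_byM/gen_by_gen.
by exists r, c, f; split=> // i; exists i.
Qed.

Definition order_ge N (p : {mpoly k[n]}) := forall m, p@_m != 0 -> (N <= mdeg m)%N.

Lemma order_ge_sum (I : Type) (s : seq I) (P : pred I) (F : I -> {mpoly k[n]}) N :
  (forall i, P i -> order_ge N (F i)) -> order_ge N (\sum_(i <- s | P i) F i).
Proof.
move=> FN; elim/big_ind: _ => // [m|p q pN qN m]; first by rewrite mcoeff0 eqxx.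
rewrite mcoeffD; have [->|/pN //] := eqVneq (p@_m) 0.
by rewrite add0r => /qN.
Qed.

Lemma order_geM a b p q : order_ge a p -> order_ge b q -> order_ge (a + b) (p * q).
Proof.
move=> pa qb m; rewrite -mcoeff_msupp => /msuppM_le/allpairsP[[m1 m2] /= []].
rewrite !mcoeff_msupp => /pa le1 /qb le2 ->.
by rewrite mdegD leq_add.
Qed.

Lemma irrelevant_exp_order N p : ideal_exp (irrelevant_ideal k n) N p -> order_ge N p.
Proof.
elim: N p => [//|N IHN] p [q [c [s [sE ->]]]]; apply: order_ge_sum => i _.
have [x [y [[q' [c' [s' [s'E ->]]]] /IHN yN ->]]] := sE i.
rewrite -[N.+1]add0n -add1n; apply: order_geM => //; apply: order_geM => //.
apply: order_ge_sum => j _; rewrite -[1%N]add0n; apply: order_geM => // m.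
have [l _ <-] := s'E j; rewrite mcoeffX.
by case: (U_(l)%MM =P m) => [<-|_]; rewrite ?mdeg1 ?eqxx.
Qed.

(* A monomial of degree at least nM + 1 is divisible by some X_i^M. *)
Lemma m_primary_exp : m_primary (ideal_span (range f)) ->
  exists N, forall p, ideal_exp (irrelevant_ideal k n) N p -> gen_by f p.
Proof.
case=> _ radI.
have powX (i : 'I_n) : exists e, gen_by f ('X_i ^+ e).
  have : radical (ideal_span (range f)) 'X_i.
    rewrite radI; exists 1%N, (fun=> 1), (fun=> 'X_i); split; first by move=> _; exists i.
    by rewrite big_ord1 mul1r.
  by case=> e /ideal_span_gen_by fX; exists e.
have [M XM] : exists M, forall i : 'I_n, gen_by f ('X_i ^+ M).
  have /boolp.choice[e eX] := powX.
  exists (\max_i e i)%N => i; rewrite -(subnK (leq_bigmax i)) exprD.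
  exact: gen_byM.
exists (n * M).+1 => p /irrelevant_exp_order pN.
rewrite (mpolyE p) big_seq; apply: gen_by_sum => m; rewrite mcoeff_msupp => /pN le_m.
have [i le_i] : exists i, (M <= m i)%N.
  apply/existsP; apply: contraTT le_m => /existsPn ltM; rewrite -ltnNge ltnS mdegE.
  have <- : (\sum_(i < n) M = n * M)%N by rewrite sum_nat_const card_ord.
  by apply: leq_sum => i _; rewrite leqNgt; apply: contra (ltM i); apply: ltnW.
rewrite -(submK (_ : (U_(i) *+ M <= m)%MM)) ?lem_mulmn1 // mpolyXD -mpolyXn.
exact/gen_byZ/gen_byM.
Qed.

(** The ideal kills [H_1]: for [g] the sum of the [q j * f j], the matrix [q i * u l] bounds [g u],
    its transposed part vanishing because [u] is a syzygy. *)
Lemma koszul_bound_gen_by (u : 'I_r -> {mpoly k[n]}) g :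
  \sum_j u j * f j = 0 -> gen_by f g -> koszul_bound f (fun l => g * u l).
Proof.
move=> uf0 [q ->].
exists (fun i l => q i * u l) => l.
under [RHS]eq_bigr => j _ do rewrite mulrBl.
rewrite sumrB mulr_suml [X in _ - X](_ : _ = 0) ?subr0.
  by apply: eq_bigr => j _; rewrite mulrAC.
under eq_bigr => j _ do rewrite -mulrA.
by rewrite -mulr_sumr uf0 mulr0.
Qed.

End IdealLemmas.

(** [infimum] picks some greatest lower bound, so an attained minimum is identified with it by
    uniqueness. *)
Lemma indeg_min (A : nzRingType) (M : subquot A) (mu : int) :
  piece_neq0 M mu -> (forall mu', piece_neq0 M mu' -> mu <= mu') ->
  indeg M = mu%:E.
Proof.
move=> Mmu minmu; rewrite /indeg; set B := [set _ | _ in _]%classic.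
have Bmu : B mu%:E by exists mu.
have infB : infimums B mu%:E.
  split=> [_ [mu' Mmu' <-]|x xB]; last exact: xB.
  by rewrite lee_fin minmu.
rewrite /infimum ifF; last by apply/negbTE/set0P; exists mu%:E.
by case: xgetP => [x -> infx|/(_ _ infB) //]; apply: is_subset1_infimums infB.
Qed.

Section Degrees.

Variables (k : fieldType) (n r d : nat) (f : 'I_r -> {mpoly k[n]}).

Lemma koszul_H1_piece (mu : int) : piece_neq0 (koszul_H f d 1) mu ->
  exists2 nu : nat, mu = nu%:Z + d%:Z & ~ koszul_exact d (nu + d) f.
Proof.
case=> a [[ha da0] apiece aden].
have {}apiece S : poly_piece (mu - d%:Z) (a S) by have := apiece S; rewrite mul1r.
(* If [mu < d] the coefficients have negative degree, so [a] is zero and bounds. *)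
move: (mu - d%:Z) (subrK d%:Z mu) apiece => [nu|nu] muE apiece; last first.
  case: aden; exists 0 => [S _|]; first by rewrite ffunE.
  apply/ffunP=> S; rewrite !ffunE big1 => [|j _]; last by rewrite ffunE mulr0.
  by rewrite (apiece S).
exists nu => // exf; case: aden; apply/koszul_boundaryP => //.
apply: exf; last exact/koszul_cycleP.
move=> j m; rewrite -mcoeff_msupp => /(dhomog_mf (apiece [set j]%SET)) /= ->.
by [].
Qed.

Lemma koszul_H1_piece_neq0 nu : ~ koszul_exact d (nu + d) f ->
  piece_neq0 (koszul_H f d 1) (nu%:Z + d%:Z).
Proof.
move=> /existsNP[u /not_implyP[hu /not_implyP[uf0 nb]]].
have uE j : deg1_coord (of_deg1 u) j = u j by apply: of_deg1K.
exists (of_deg1 u); split.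
- split; first exact: of_deg1_mod.
  apply/koszul_cycleP; first exact: of_deg1_mod.
  by under eq_bigr do rewrite uE.
- move=> S; rewrite mul1r addrK /poly_piece /=; rewrite ffunE.
  case: pickP => [j _|_]; last exact: rpred0.
  by apply/dhomogP => m; rewrite mcoeff_msupp => /hu/eqP; rewrite eqn_add2r => /eqP.
- move=> /(koszul_boundaryP _ (of_deg1_mod u))[C uC]; apply: nb; exists C => l.
  by rewrite -uC uE.
Qed.

(** A power of the irrelevant ideal lies in the ideal of the forms, which kills [H_1]; hence every
    class is torsion. *)
Lemma koszul_H1_torsion mu : m_primary (ideal_span (range f)) ->
  piece_neq0 (H0m (koszul_H f d 1)) mu <-> piece_neq0 (koszul_H f d 1) mu.
Proof.
move=> mI; split=> [[a [[numa _] pa dena]]|[a [[ha da0] pa dena]]]; exists a; split=> //.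
split=> //; have [N genN] := m_primary_exp mI.
exists N => g /genN genfg; have hga : koszul_mod 1 (g *: a).
  by move=> S nS; rewrite ffunE ha // scaler0.
apply/(koszul_boundaryP _ hga).
have [C gaC] := koszul_bound_gen_by ((koszul_cycleP _ ha).1 da0) genfg.
by exists C => l; rewrite -gaC /deg1_coord ffunE.
Qed.

(** Both initial degrees equal [nu + d] for the least inexact [nu], so the minimum of [nu + d] and
    [(nu + d) - d] is [nu]. *)
Lemma threshold_degreeE nu0 : m_primary (ideal_span (range f)) ->
  ~ koszul_exact d (nu0 + d) f ->
  exists2 nu : nat, (nu <= nu0)%N /\ ~ koszul_exact d (nu + d) f &
    threshold_degree f d = ((n%:Z - 1) * (d%:Z - 1) - nu%:Z)%:E.
Proof.
move=> mI nex0.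
have exP : exists nu, `[< ~ koszul_exact d (nu + d) f >] by exists nu0; apply/asboolP.
case: (ex_minnP exP) => nu /asboolP nex nu_min; exists nu.
  by split=> //; apply: nu_min; apply/asboolP.
have minH1 mu : piece_neq0 (koszul_H f d 1) mu -> nu%:Z + d%:Z <= mu.
  case/koszul_H1_piece => nu' -> nex'; rewrite lerD2r lez_nat.
  by apply: nu_min; apply/asboolP.
rewrite /threshold_degree (indeg_min (koszul_H1_piece_neq0 nex)) //.
rewrite (@indeg_min _ (H0m (koszul_H f d 1)) (nu%:Z + d%:Z)); last first.
- by move=> mu /(koszul_H1_torsion _ mI); apply: minH1.
- exact/(koszul_H1_torsion _ mI)/koszul_H1_piece_neq0.
rewrite -EFinB addrK min_r ?lee_fin ?lerDl //.
Qed.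

End Degrees.

(** * The two bounds and generic equality *)

Local Open Scope classical_set_scope.

Theorem corollary3 (k : fieldType) (n d : nat) (hn : (2 <= n)%N)
    (hd : (1 <= d)%N) :
  (forall f : 'I_n.+1 -> {mpoly k[n]},
     (forall i, f i \is d.-homog) ->
     lin_indep f ->
     m_primary (ideal_span (range f)) ->
     ((((n%:Z - 1) * (d%:Z - 1)) %/ 2)%Z%:E <= threshold_degree f d)%E /\
     (threshold_degree f d <= ((n%:Z - 1) * (d%:Z - 1))%:E)%E)
  /\
  ([pchar k] =i pred0 ->
   exists U : set ('I_#|coef_index n n.+1 d| -> k),
     [/\ zariski_open U, U !=set0 &
       forall f : 'I_n.+1 -> {mpoly k[n]},
         (forall i, f i \is d.-homog) ->
         lin_indep f ->
         m_primary (ideal_span (range f)) ->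
         U (coef_point d f) ->
         (((n%:Z - 1) * (d%:Z - 1)) %/ 2)%Z%:E = threshold_degree f d]).
Proof.
pose nu0 := uphalf (n.-1 * d.-1).
have s_ge : (n * d.-1 = n.-1 * d.-1 + d.-1)%N by case: n hn {nu0} => // n' _; rewrite mulSn addnC.
have pred_ge : (d.-1 <= n.-1 * d.-1)%N by rewrite -{1}[d.-1]mul1n leq_mul2r; lia.
(* Rounding [nu0] up makes the difference the rounded-down half. *)
have halfE : (((n%:Z - 1) * (d%:Z - 1)) %/ 2)%Z =
    (n%:Z - 1) * (d%:Z - 1) - nu0%:Z.
  have -> : (n%:Z - 1) * (d%:Z - 1) = (n.-1 * d.-1)%N%:Z.
    by rewrite PoszM; congr (_ * _); lia.
  rewrite /nu0; move: (n.-1 * d.-1)%N => t; lia.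
have nex (f : 'I_n.+1 -> {mpoly k[n]}) : (forall i, f i \is d.-homog) ->
    ~ koszul_exact d (nu0 + d) f.
  case: d hd @nu0 s_ge pred_ge {halfE} => // d' _ nu0 /= s_ge pred_ge hf.
  by apply: not_koszul_exact => //; rewrite s_ge /nu0; lia.
split=> [f hf _ mI|k0].
  have [nu [le_nu _] ->] := threshold_degreeE mI (nex f hf).
  by rewrite halfE !lee_fin; lia.
have [s [nz exs]] := koszul_exact_generic n hd k0.
(* The open set is nonempty because it contains the coefficients of [witness]. *)
exists [set a | s.@[a] != 0]; split.
- exists [set s]; apply/seteqP; split=> [a sa|a [_ -> //]].
  by exists s.
- by exists (coef_point d (@witness k n d)).
- move=> f hf _ mI sf.
  have [nu [le_nu nexf] ->] := threshold_degreeE mI (nex f hf).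
  rewrite halfE; congr (_ - _%:Z)%:E; apply/eqP; rewrite eqn_leq le_nu andbT leqNgt.
  (* [nu < nu0] means [2 nu + 1 <= (n - 1) (d - 1)], that is [2 nu + d <= n (d - 1)], the range of
     generic exactness. *)
  apply/negP => lt_nu; apply: nexf; apply: exs => //.
  by move: lt_nu; rewrite s_ge /nu0; lia.
Qed.
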